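(* Let $\pi,\phi\in(0,1)$ and $\theta\in(0,1]$. In any equilibrium, the price of the asset in the blockchain market is higher than the price in the cash market: $P_B>P_C$.
   Context: Two platforms, the blockchain market ($B$) and the cash market ($C$), trade an asset of high or low quality. $\pi$ is the economy-wide fraction of high-quality assets, $\phi$ is the relative value of a low-quality asset, and $\theta$ is the probability that a low-quality asset offered in $B$ is detected and rejected. Private values are uniform on $[0,1]$. $\pi_B$ is the fraction of high-quality assets among assets traded in $B$, the corresponding fraction in $C$ is $\pi_C=0$, and $\tilde\pi_B=\pi_B+(1-\pi_B)\phi$. An equilibrium is a tuple $(Q,P_B,P_C,\pi_B,K_B,K_C)$ with $P_B,P_C>0$, $K_B>0$, $K_C\ge 0$ such that both markets clear, $K_j=K_j^S=K_j^D$ for $j\in\{B,C\}$, where $$\alpha_I=\max\Big\{\tfrac{P_C-(1-\theta)P_B}{\phi\theta},0\Big\},$$ $$K_C^S=(1-\pi)\alpha_I,\qquad K_B^S=\pi P_B+(1-\pi)(1-\theta)\Big(\tfrac{P_B}{\phi}-\alpha_I\Big),$$ $$K_B^D=1-\frac{P_B-P_C}{\tilde\pi_B-\phi},\qquad K_C^D=\frac{P_B-P_C}{\tilde\pi_B-\phi}-\frac{P_C}{\phi},$$ $$\pi_B=\frac{\pi P_B}{K_B},\qquad Q=P_BK_B .$$ Note that $\tilde\pi_B-\phi=(1-\phi)\pi_B$. *)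

(* Defs.v *)
From mathcomp Require Import all_boot all_order all_algebra.
Set Implicit Arguments.
Unset Strict Implicit.
Unset Printing Implicit Defensive.
Import Order.TTheory GRing.Theory Num.Theory.
Local Open Scope ring_scope.

(* [pi], [phi], [theta]: economy-wide fraction of high-quality assets, relative
   value of a low-quality asset, and probability that a low-quality asset
   offered in the blockchain market B is detected and rejected.  [PB], [PC]
   are the prices in B and in the cash market C; [piB] is the fraction of
   high-quality assets among those traded in B (this fraction is 0 in C). *)
Section Market.
Variable R : realFieldType.
Implicit Types pi phi theta PB PC piB : R.

Definition alphaI phi theta PB PC : R :=
  Num.max ((PC - (1 - theta) * PB) / (phi * theta)) 0.

Definition supplyC pi phi theta PB PC : R :=
  (1 - pi) * alphaI phi theta PB PC.

Definition supplyB pi phi theta PB PC : R :=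
  pi * PB + (1 - pi) * (1 - theta) * (PB / phi - alphaI phi theta PB PC).

(* Expected relative value of an asset bought in B. *)
Definition tpiB phi piB : R := piB + (1 - piB) * phi.

Definition demandB phi PB PC piB : R :=
  1 - (PB - PC) / (tpiB phi piB - phi).

Definition demandC phi PB PC piB : R :=
  (PB - PC) / (tpiB phi piB - phi) - PC / phi.

Record is_equilibrium (pi phi theta Q PB PC piB KB KC : R) : Prop :=
  IsEquilibrium {
    eq_PB_gt0 : 0 < PB;
    eq_PC_gt0 : 0 < PC;
    eq_KB_gt0 : 0 < KB;
    eq_KC_ge0 : 0 <= KC;
    eq_supplyB : KB = supplyB pi phi theta PB PC;
    eq_demandB : KB = demandB phi PB PC piB;
    eq_supplyC : KC = supplyC pi phi theta PB PC;
    eq_demandC : KC = demandC phi PB PC piB;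
    eq_piB : piB = pi * PB / KB;
    eq_Q : Q = PB * KB
  }.

End Market.

(* Main.v *)
Require Import Defs.
From mathcomp Require Import all_boot all_order all_algebra.
From mathcomp Require Import ring.
Import Order.TTheory GRing.Theory Num.Theory.
Local Open Scope ring_scope.

(** Demand in the cash market carries the argument: [KC >= 0] forces [(PB - PC) / (tpiB phi piB -
    phi) >= PC / phi > 0]. The denominator equals [(1 - phi) * piB], which is positive because
    high-quality assets do trade in B, so the numerator [PB - PC] is positive too. *)

Theorem proposition2 (R : realFieldType) (pi phi theta : R)
  (hpi : 0 < pi < 1) (hphi : 0 < phi < 1) (htheta : 0 < theta <= 1)
  (Q PB PC piB KB KC : R)
  (heq : is_equilibrium pi phi theta Q PB PC piB KB KC) :
  PC < PB.
Proof.
case: heq => PB_gt0 PC_gt0 KB_gt0 KC_ge0 _ _ _ defKC defpiB _.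
have /andP[pi_gt0 _] := hpi; have /andP[phi_gt0 phi_lt1] := hphi.
have piB_gt0 : 0 < piB by rewrite defpiB divr_gt0 ?mulr_gt0.
have den_gt0 : 0 < tpiB phi piB - phi.
  have -> : tpiB phi piB - phi = (1 - phi) * piB by rewrite /tpiB; ring.
  by rewrite mulr_gt0 ?subr_gt0.
rewrite defKC /demandC subr_ge0 in KC_ge0.
have := lt_le_trans (divr_gt0 PC_gt0 phi_gt0) KC_ge0.
(* The quotient is a product with an inverse, whose sign [den_gt0] settles. *)
by rewrite pmulr_lgt0 ?invr_gt0 // subr_gt0.
Qed.
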